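(* Let $p\in(0,1)$ and let $f$ be a continuously differentiable real function on a neighbourhood of $[-1,1]^n$. Define $I_p(y)=\sum_{i=1}^n I_p(y_i)$ for $y\in\mathbb{R}^n$, where for $x\in[-1,1]$, $I_p(x)=\frac{1+x}{2}\log\frac{1+x}{2p}+\frac{1-x}{2}\log\frac{1-x}{2(1-p)}$ and $I_p(x)=+\infty$ otherwise, and define $\phi_p(t)=\inf\{I_p(y): f(y)\ge t,\ y\in[-1,1]^n\}$ for $t\in\mathbb{R}$. Let $t\in\mathbb{R}$, $\delta>0$, and assume $\phi_p(s)>\phi_p(t-\delta)$ for all $s>t-\delta$. Let $V=\nabla f([-1,1]^n)$, $L=\sup_{x\in[-1,1]^n}\|\nabla f(x)\|_{\ell^2}$, and let $X$ be a random vector with law $\mu_p^n$, where $\mu_p=(1-p)\delta_{-1}+p\delta_1$. There exist universal constants $C,\kappa>0$ such that if $b(V)\le\delta/\kappa$, then $$\log\mathbb{P}(f(X)\ge t)\le-\phi_p(t-\delta)+C\log\Big(\frac{nL\log(1/(p(1-p)))}{\delta}\Big).$$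
   Context: $b(V)=\mathbb{E}\sup_{\xi\in V}\langle\xi,\varepsilon\rangle$ with $\varepsilon$ uniformly distributed on $\{-1,1\}^n$. *)

(* Defs.v *)
From HB Require Import structures.
From mathcomp Require Import all_boot all_order all_algebra.
From mathcomp Require Import all_classical all_reals all_analysis.
Set Implicit Arguments. Unset Strict Implicit. Unset Printing Implicit Defensive.
Import Order.TTheory GRing.Theory Num.Theory.
Import numFieldNormedType.Exports.
Local Open Scope classical_set_scope.
Local Open Scope ring_scope.

Section Defs.
Variable R : realType.

Definition cube (n : nat) : set 'rV[R]_n :=
  [set y | forall i : 'I_n, -1 <= y ord0 i <= 1].


Definition partial (n : nat) (f : 'rV[R]_n -> R) (i : 'I_n) (x : 'rV[R]_n) : R :=
  'D_(delta_mx ord0 i) f x.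
Definition grad (n : nat) (f : 'rV[R]_n -> R) (x : 'rV[R]_n) : 'rV[R]_n :=
  \row_i partial f i x.

Definition C1_near_cube (n : nat) (f : 'rV[R]_n -> R) : Prop :=
  exists U : set 'rV[R]_n, open U /\ (@cube n) `<=` U /\
    (forall x, U x -> differentiable f x) /\
    (forall x, U x -> {for x, continuous (grad f)}).

Definition dotv (n : nat) (u v : 'rV[R]_n) : R := \sum_(i < n) u ord0 i * v ord0 i.
Definition l2norm (n : nat) (u : 'rV[R]_n) : R := Num.sqrt (dotv u u).

Definition sgnv (n : nat) (w : {ffun 'I_n -> bool}) : 'rV[R]_n :=
  \row_i (if w i then 1 else -1).

Definition bV (n : nat) (V : set 'rV[R]_n) : R :=
  (2 ^- n) * \sum_(w : {ffun 'I_n -> bool}) sup [set dotv xi (sgnv w) | xi in V].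

Definition Lgrad (n : nat) (f : 'rV[R]_n -> R) : R :=
  sup [set l2norm (grad f x) | x in (@cube n)].

(* rate function; 0 log 0 = 0 holds automatically since ln 0 = 0 in mathcomp *)
Definition Ip1 (p x : R) : \bar R :=
  if (-1 <= x <= 1) then
    ((1 + x) / 2 * ln ((1 + x) / (2 * p)) + (1 - x) / 2 * ln ((1 - x) / (2 * (1 - p))))%:E
  else +oo%E.
Definition Ip (n : nat) (p : R) (y : 'rV[R]_n) : \bar R :=
  (\sum_(i < n) Ip1 p (y ord0 i))%E.

Definition phi (n : nat) (p : R) (f : 'rV[R]_n -> R) (t : R) : \bar R :=
  ereal_inf [set Ip p y | y in [set y | (@cube n) y /\ t <= f y]].

Definition mupn_weight (n : nat) (p : R) (w : {ffun 'I_n -> bool}) : R :=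
  \prod_(i < n) (if w i then p else 1 - p).
Definition prob_ge (n : nat) (p : R) (f : 'rV[R]_n -> R) (t : R) : R :=
  \sum_(w : {ffun 'I_n -> bool} | t <= f (sgnv w)) mupn_weight p w.

End Defs.
Arguments cube {R} n.

(* Main.v *)
Require Import Defs.
From HB Require Import structures.
From mathcomp Require Import all_boot all_order all_algebra.
From mathcomp Require Import all_classical all_reals all_analysis.
From mathcomp Require Import ring lra.
Import Order.TTheory GRing.Theory Num.Theory.
Import numFieldNormedType.Exports.
Local Open Scope classical_set_scope.
Local Open Scope ring_scope.

(* Write D(v) = sup_(xi in V) <xi, v>. For X of law Q on the cube, reveal the
   coordinates one by one and let Y_i = E(X_i | X_1, ..., X_(i-1)). By the chain
   rule E I_p(Y) is the entropy of Q relative to mu_p^n, and the coordinates of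
   X - Y are two-point martingale increments in [-2, 2], so that E Phi(X - Y) <=
   E Phi(2 eps) for convex Phi. With Q the tilted law and Phi = lam * D this gives
     log E exp(inf_y {I_p(y) + lam * D(X - y)}) <= 2 lam b(V).
   Put c = phi_p(t - delta) and let f(x) >= t. Every y with I_p(y) < c has
   f(y) < t - delta, hence D(x - y) > delta by the mean value theorem. As I_p and D
   are convex, there is a multiplier lam(x) >= 0 with
     I_p(y) + lam(x) D(x - y) >= c + lam(x) delta for all y in the cube.
   Taking y = x bounds lam(x), so up to an error 1 in the exponent lam(x) takes
   polynomially many values in n L log(1/(p(1-p))) / delta, and each contributes
   exp(2 lam b(V) - c - lam delta) <= exp(-c) to the probability if kappa = 2.
   The constants are absorbed in C because the argument of the final logarithm is at
   least 61/60: the mean of mu_p^n lies in {f <= t - delta}, which bounds delta. *)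

(** * Convexity of the rate function and transport for one coordinate *)

Section Rate.
Variable R : realType.
Implicit Types a b m p q r s x y : R.

Lemma ln_le_subr1 x : 0 < x -> ln x <= x - 1.
Proof. by move=> x0; rewrite -{1}(subrKC 1 x) le_ln1Dx //; lra. Qed.

(** This is [ln (m / a) <= m / a - 1] multiplied by [a]: the tangent line at [m] of a convex
    function. *)
Lemma mul_ln_tangent r a m : 0 < r -> 0 <= a -> 0 < m ->
  a * ln (m / r) + (a - m) <= a * ln (a / r).
Proof.
move=> r0 a0 m0; have [->|an0] := eqVneq a 0; first by rewrite !mul0r; lra.
have {a0} an0 : 0 < a by rewrite lt_def an0.
rewrite !ln_div ?posrE//.
have : ln (m / a) <= m / a - 1 by rewrite ln_le_subr1 ?divr_gt0.
rewrite ln_div ?posrE// -(ler_pM2l an0) !mulrBr mulrCA divff ?gt_eqF//; lra.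
Qed.

(** Tangent inequalities at the mean [m] are averaged, and the first-order terms cancel. The case
    [m = 0] is apart, as the tangent there is vertical. *)
Lemma mul_ln_convex r a b s : 0 < r -> 0 <= a -> 0 <= b -> 0 <= s <= 1 ->
  (s * a + (1 - s) * b) * ln ((s * a + (1 - s) * b) / r) <=
  s * (a * ln (a / r)) + (1 - s) * (b * ln (b / r)).
Proof.
move=> r0 a0 b0 /andP[s0 s1]; set m := s * a + _.
have s1' : 0 <= 1 - s by lra.
have sa0 : 0 <= s * a by rewrite mulr_ge0.
have sb0 : 0 <= (1 - s) * b by rewrite mulr_ge0.
have [m0|mn0] := eqVneq m 0.
  have sa : s * a = 0 by rewrite /m in m0; lra.
  have sb : (1 - s) * b = 0 by rewrite /m in m0; lra.
  by rewrite m0 !mulrA sa sb !mul0r addr0.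
have {mn0} mn0 : 0 < m by rewrite lt_def mn0 /m addr_ge0.
have := ler_wpM2l s0 (mul_ln_tangent r a m r0 a0 mn0).
have := ler_wpM2l s1' (mul_ln_tangent r b m r0 b0 mn0).
move: (ln (m / r)) (ln (a / r)) (ln (b / r)) => u v w.
suff -> : m * u = s * (a * u + (a - m)) + (1 - s) * (b * u + (b - m)) by lra.
by rewrite /m; ring.
Qed.

Definition rate p x : R :=
  (1 + x) / 2 * ln ((1 + x) / (2 * p)) + (1 - x) / 2 * ln ((1 - x) / (2 * (1 - p))).

(** With tangents taken at [2 * p] and [2 * (1 - p)] the logarithms vanish and the linear terms
    cancel. *)
Lemma rate_ge0 p x : 0 < p < 1 -> -1 <= x <= 1 -> 0 <= rate p x.
Proof.
move=> /andP[p0 p1] /andP[x0 x1].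
have := mul_ln_tangent (2 * p) (1 + x) (2 * p).
have := mul_ln_tangent (2 * (1 - p)) (1 - x) (2 * (1 - p)).
rewrite !divff; [|lra..].
rewrite !ln1 /rate => /(_ _ _ _)/[swap] h1 /(_ _ _ _) h2.
have {}h1 := h1 ltac:(lra) ltac:(lra) ltac:(lra).
have {}h2 := h2 ltac:(lra) ltac:(lra) ltac:(lra).
by lra.
Qed.

Lemma rate_mean p : 0 < p < 1 -> rate p (2 * p - 1) = 0.
Proof.
move=> /andP[p0 p1]; rewrite /rate.
have -> : 1 + (2 * p - 1) = 2 * p by ring.
have -> : 1 - (2 * p - 1) = 2 * (1 - p) by ring.
by rewrite !divff ?ln1 ?mulr0 ?addr0//; lra.
Qed.

Lemma rate_sign p (c : bool) : 0 < p < 1 ->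
  rate p (if c then 1 else -1) <= ln (1 / (p * (1 - p))).
Proof.
move=> /andP[p0 p1]; rewrite /rate.
have lnp : ln p <= 0 by apply/ln_le0/ltW.
have lnq : ln (1 - p) <= 0 by apply/ln_le0; lra.
have -> : ln (1 / (p * (1 - p))) = - ln p - ln (1 - p).
  by rewrite div1r lnV ?lnM ?posrE ?mulr_gt0 ?subr_gt0// opprD.
case: c.
  rewrite subrr !mul0r addr0 (_ : (1 + 1) / 2 = 1 :> R) ?mul1r; last by field.
  rewrite (_ : (1 + 1) / (2 * p) = p^-1); last by field; lra.
  by rewrite lnV ?posrE//; lra.
rewrite subrr !mul0r add0r opprK (_ : (1 + 1) / 2 = 1 :> R) ?mul1r; last by field.
rewrite (_ : (1 + 1) / (2 * (1 - p)) = (1 - p)^-1); last by field; lra.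
by rewrite lnV ?posrE ?subr_gt0//; lra.
Qed.

Lemma rate_convex p x y s : 0 < p < 1 -> -1 <= x <= 1 -> -1 <= y <= 1 ->
  0 <= s <= 1 -> rate p (s * x + (1 - s) * y) <= s * rate p x + (1 - s) * rate p y.
Proof.
move=> /andP[p0 p1] /andP[x0 x1] /andP[y0 y1] s01.
have := mul_ln_convex (2 * p) (1 + x) (1 + y) s.
have := mul_ln_convex (2 * (1 - p)) (1 - x) (1 - y) s.
rewrite (_ : s * (1 - x) + (1 - s) * (1 - y) = 1 - (s * x + (1 - s) * y)); last by ring.
rewrite (_ : s * (1 + x) + (1 - s) * (1 + y) = 1 + (s * x + (1 - s) * y)); last by ring.
rewrite /rate => h1 h2.
have {}h1 := h1 ltac:(lra) ltac:(lra) ltac:(lra) s01.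
have {}h2 := h2 ltac:(lra) ltac:(lra) ltac:(lra) s01.
by lra.
Qed.

(* Take for [y] the mean of the tilt of [mu_p] by the exponents [a], [b]: for this
   tilt the Gibbs variational principle is an equality. *)
Lemma two_point_transport p a b (Psi : R -> R) : 0 < p < 1 ->
  (forall x y s, 0 <= s <= 1 ->
     Psi (s * x + (1 - s) * y) <= s * Psi x + (1 - s) * Psi y) ->
  (forall y, -1 <= y <= 1 -> a <= rate p y + Psi (1 - y)) ->
  (forall y, -1 <= y <= 1 -> b <= rate p y + Psi (-1 - y)) ->
  p * expR a + (1 - p) * expR b <= expR ((Psi 2 + Psi (-2)) / 2).
Proof.
move=> /andP[p0 p1] cvx ha hb.
set Z := p * _ + _.
have pa : 0 < p * expR a by rewrite mulr_gt0 ?expR_gt0.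
have pb : 0 < (1 - p) * expR b by rewrite mulr_gt0 ?expR_gt0 ?subr_gt0.
have Z0 : 0 < Z by rewrite addr_gt0.
pose q := p * expR a / Z.
have q1E : 1 - q = (1 - p) * expR b / Z.
  by rewrite /q -[X in X - _](@divff _ Z) ?gt_eqF// -mulrBl /Z; congr (_ / _); ring.
have q0 : 0 < q by rewrite divr_gt0.
have q1 : 0 < 1 - q by rewrite q1E divr_gt0.
have rE : rate p (2 * q - 1) = q * a + (1 - q) * b - ln Z.
  rewrite /rate.
  have -> : (1 + (2 * q - 1)) / (2 * p) = expR a / Z.
    by rewrite /q; field; rewrite !gt_eqF.
  have -> : (1 - (2 * q - 1)) / (2 * (1 - p)) = expR b / Z.
    have -> : 1 - (2 * q - 1) = 2 * (1 - q) by ring.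
    by rewrite q1E; field; rewrite !gt_eqF// subr_gt0.
  by rewrite !ln_div ?posrE ?expR_gt0// !expRK; field.
have yI : -1 <= 2 * q - 1 <= 1 by lra.
have {}ha := ler_wpM2l (ltW q0) (ha _ yI).
have {}hb := ler_wpM2l (ltW q1) (hb _ yI).
(* For the mean [y = 2 * q - 1], the increments [1 - y] and [-1 - y] lie in [-2, 2]; each is a
   convex combination of 2 and -2. *)
have c1 : Psi (1 - (2 * q - 1)) <= (1 - q / 2) * Psi 2 + (q / 2) * Psi (-2).
  have := cvx 2 (-2) (1 - q / 2) ltac:(lra).
  by rewrite (_ : _ + _ * -2 = 1 - (2 * q - 1)) ?subKr//; field.
have c2 : Psi (-1 - (2 * q - 1)) <= ((1 - q) / 2) * Psi 2 + ((1 + q) / 2) * Psi (-2).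
  have := cvx 2 (-2) ((1 - q) / 2) ltac:(lra).
  rewrite (_ : _ + _ * -2 = -1 - (2 * q - 1)); last by field.
  by rewrite (_ : 1 - (1 - q) / 2 = (1 + q) / 2)//; field.
have {}c1 := ler_wpM2l (ltW q0) c1.
have {}c2 := ler_wpM2l (ltW q1) c2.
rewrite -[leLHS]lnK ?posrE// ler_expR.
have -> : ln Z = q * a + (1 - q) * b - rate p (2 * q - 1) by rewrite rE; ring.
(* The increment has mean 0 under the weights [q] and [1 - q], so the averaged combinations put mass
   1/2 on each of 2 and -2. *)
have -> : (Psi 2 + Psi (-2)) / 2 = q * ((1 - q / 2) * Psi 2 + (q / 2) * Psi (-2))
  + (1 - q) * (((1 - q) / 2) * Psi 2 + ((1 + q) / 2) * Psi (-2)) by field.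
move: ha hb c1 c2.
move: (Psi (1 - _)) (Psi (-1 - _)) (Psi 2) (Psi (-2)) (rate p _) => u v w z r ha hb c1 c2.
apply: le_trans (lerD c1 c2).
rewrite [leRHS](_ : _ = q * (r + u) + (1 - q) * (r + v) - r); last by ring.
by rewrite lerB// lerD.
Qed.

End Rate.

(** * Tensorization over the coordinates of the cube *)

Section Tensor.
Variable R : realType.
Implicit Types p s u : R.

Definition vcons (n : nat) (u : R) (v : 'rV[R]_n) : 'rV[R]_n.+1 :=
  \row_i oapp (v ord0) u (unlift ord0 i).

Definition fcons (n : nat) (b : bool) (w : {ffun 'I_n -> bool}) :
    {ffun 'I_n.+1 -> bool} :=
  [ffun i => oapp w b (unlift ord0 i)].

Lemma vcons_head n u (v : 'rV[R]_n) : vcons n u v ord0 ord0 = u.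
Proof. by rewrite mxE unlift_none. Qed.

Lemma vcons_tail n u (v : 'rV[R]_n) i : vcons n u v ord0 (lift ord0 i) = v ord0 i.
Proof. by rewrite mxE liftK. Qed.

Lemma eq_vcons n (a : 'rV[R]_n.+1) u (v : 'rV[R]_n) :
  a ord0 ord0 = u -> (forall i, a ord0 (lift ord0 i) = v ord0 i) -> a = vcons n u v.
Proof.
move=> h t; apply/rowP => i; have [j ->|->] := unliftP ord0 i.
  by rewrite vcons_tail t.
by rewrite vcons_head h.
Qed.

Lemma fcons_head n b (w : {ffun 'I_n -> bool}) : fcons n b w ord0 = b.
Proof. by rewrite ffunE unlift_none. Qed.

Lemma fcons_tail n b (w : {ffun 'I_n -> bool}) i : fcons n b w (lift ord0 i) = w i.
Proof. by rewrite ffunE liftK. Qed.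

Lemma sum_ffunS n (F : {ffun 'I_n.+1 -> bool} -> R) :
  \sum_w F w = \sum_w F (fcons n true w) + \sum_w F (fcons n false w).
Proof.
pose h (bw : bool * {ffun 'I_n -> bool}) := fcons n bw.1 bw.2.
rewrite (reindex h) /=; last first.
  exists (fun w => (w ord0, [ffun i => w (lift ord0 i)])) => [[b w] _|w _].
    rewrite /h fcons_head; congr pair; apply/ffunP => i.
    by rewrite ffunE fcons_tail.
  apply/ffunP => i; rewrite /h; have [j ->|->] := unliftP ord0 i.
    by rewrite fcons_tail ffunE.
  by rewrite fcons_head.
by rewrite -(pair_bigA _ (fun b w => F (fcons n b w))) big_bool.
Qed.

Lemma sgnv_fcons n b (w : {ffun 'I_n -> bool}) :
  sgnv R (fcons n b w) = vcons n (if b then 1 else -1) (sgnv R w).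
Proof.
by apply: eq_vcons => [|i]; rewrite !mxE ?fcons_head ?fcons_tail.
Qed.

Lemma mupn_weight_fcons (p : R) n b (w : {ffun 'I_n -> bool}) :
  mupn_weight p (fcons n b w) = (if b then p else 1 - p) * mupn_weight p w.
Proof.
rewrite /mupn_weight big_ord_recl fcons_head; congr *%R.
by apply: eq_bigr => i _; rewrite fcons_tail.
Qed.

Lemma mupn_weight_gt0 (p : R) n (w : {ffun 'I_n -> bool}) : 0 < p < 1 ->
  0 < mupn_weight p w.
Proof.
by move=> p01; rewrite prodr_gt0// => i _; case: ifP => _; lra.
Qed.

Definition convex_rV n (Phi : 'rV[R]_n -> R) := forall x y s, 0 <= s <= 1 ->
  Phi (s *: x + (1 - s) *: y) <= s * Phi x + (1 - s) * Phi y.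

Lemma vconsZ n a u (v : 'rV[R]_n) : a *: vcons n u v = vcons n (a * u) (a *: v).
Proof.
by apply: eq_vcons => [|i]; rewrite [LHS]mxE ?vcons_head// vcons_tail [RHS]mxE.
Qed.

Lemma vconsD n u1 u2 (v1 v2 : 'rV[R]_n) :
  vcons n u1 v1 + vcons n u2 v2 = vcons n (u1 + u2) (v1 + v2).
Proof.
by apply: eq_vcons => [|i]; rewrite [LHS]mxE ?vcons_head// !vcons_tail [RHS]mxE.
Qed.

Lemma vconsB n u1 u2 (v1 v2 : 'rV[R]_n) :
  vcons n u1 v1 - vcons n u2 v2 = vcons n (u1 - u2) (v1 - v2).
Proof. by rewrite -scaleN1r vconsZ vconsD mulN1r scaleN1r. Qed.

Lemma comb_id n s (x : 'rV[R]_n) : s *: x + (1 - s) *: x = x.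
Proof. by rewrite -scalerDl subrKC scale1r. Qed.

(* The hypothesis holds for every pair [(w, y)], so each coordinate of [y] may be
   chosen depending on the earlier coordinates of [w], but not on its own. *)
Lemma cube_transport n (p : R) (Phi : 'rV[R]_n -> R) (g : {ffun 'I_n -> bool} -> R) :
  0 < p < 1 -> convex_rV n Phi ->
  (forall w y, cube n y ->
     g w <= \sum_(i < n) rate R p (y ord0 i) + Phi (sgnv R w - y)) ->
  \sum_w mupn_weight p w * expR (g w) <=
  expR (2 ^- n * \sum_(w : {ffun 'I_n -> bool}) Phi (2 *: sgnv R w)).
Proof.
move=> p01; elim: n => [|n IH] in Phi g * => cvx hg.
  have w0 (w : {ffun 'I_0 -> bool}) : w = [ffun=> true] by apply/ffunP => -[].
  rewrite (bigD1 [ffun=> true])//= big1 ?addr0 => [|w]; last by rewrite (w0 w) eqxx.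
  rewrite (bigD1 [ffun=> true])//= big1 ?addr0 => [|w]; last by rewrite (w0 w) eqxx.
  rewrite /mupn_weight big_ord0 mul1r expr0 invr1 mul1r ler_expR.
  have := hg [ffun=> true] 0 ltac:(by case).
  rewrite big_ord0 add0r; congr (_ <= Phi _).
  by apply/rowP => -[].
pose sg (b : bool) : R := if b then 1 else -1.
(* [Psi] averages over the signs of the later coordinates; [Z b] is the exponential moment given the
   first sign [b]. *)
pose Psi u := 2 ^- n * \sum_(w : {ffun 'I_n -> bool}) Phi (vcons n u (2 *: sgnv R w)).
pose Z b := \sum_w mupn_weight p w * expR (g (fcons n b w)).
have Z0 b : 0 < Z b.
  rewrite /Z (bigD1 [ffun=> true])//= ltr_pwDl ?mulr_gt0 ?mupn_weight_gt0 ?expR_gt0//.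
  by apply: sumr_ge0 => w _; rewrite mulr_ge0 ?expR_ge0// ltW ?mupn_weight_gt0.
have hZ b y : -1 <= y <= 1 -> ln (Z b) <= rate R p y + Psi (sg b - y).
  move=> y01.
  (* For a fixed first coordinate [y], its cost enters the induction hypothesis as a constant added
     to [Phi]. *)
  have /IH : convex_rV n (fun v => rate R p y + Phi (vcons n (sg b - y) v)).
    move=> u v s s01 /=.
    have := cvx (vcons n (sg b - y) u) (vcons n (sg b - y) v) s s01.
    by rewrite !vconsZ vconsD -mulrDl subrKC mul1r; lra.
  move=> /(_ (fun w => g (fcons n b w)))/=.
  rewrite -/(Z b) => IHb.
  have : Z b <= expR (rate R p y + Psi (sg b - y)).
    apply: le_trans (IHb _) _.
      move=> w v cv; have cy : cube n.+1 (vcons n y v).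
        by move=> i; have [j ->|->] := unliftP ord0 i; rewrite ?vcons_tail ?vcons_head.
      have := hg (fcons n b w) _ cy; rewrite big_ord_recl vcons_head sgnv_fcons.
      rewrite vconsB.
      rewrite [X in _ + X + _](eq_bigr (fun i => rate R p (v ord0 i))) => [|i _].
        by rewrite -addrA addrCA.
      by rewrite vcons_tail.
    rewrite ler_expR /Psi big_split/= mulrDr sumr_const card_ffun card_bool card_ord.
    by rewrite -[X in _ * X + _]mulr_natr natrX mulrCA mulVf ?mulr1 //.
  by move=> H; rewrite -[leRHS]expRK ler_ln ?posrE ?expR_gt0.
have PsiC x y s : 0 <= s <= 1 ->
     Psi (s * x + (1 - s) * y) <= s * Psi x + (1 - s) * Psi y.
  move=> s01; rewrite /Psi (mulrCA s) (mulrCA (1 - s)) -mulrDr.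
  rewrite ler_wpM2l// !mulr_sumr -big_split ler_sum// => w _ /=.
  have := cvx (vcons n x (2 *: sgnv R w)) (vcons n y (2 *: sgnv R w)) s s01.
  by rewrite !vconsZ vconsD comb_id.
have := two_point_transport R p (ln (Z true)) (ln (Z false)) Psi p01 PsiC.
move=> /(_ (hZ true) (hZ false)); rewrite !lnK ?posrE//.
congr (_ <= expR _).
  rewrite sum_ffunS !mulr_sumr.
  by congr +%R; apply: eq_bigr => w _; rewrite mupn_weight_fcons mulrA.
rewrite /Psi -mulrDr sum_ffunS mulrC exprS invfM -!mulrA; congr (_ * (_ * (_ + _))).
  apply: eq_bigr => w _; congr Phi; rewrite sgnv_fcons.
  by rewrite vconsZ mulr1.
apply: eq_bigr => w _; congr Phi; rewrite sgnv_fcons.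
by rewrite vconsZ mulrN1.
Qed.

End Tensor.

(** * Lagrange multiplier for one convex constraint *)

Section Lagrange.
Variable R : realType.

(** Points with [I y < c] bound the multiplier from below, points with [D y < d] from above.
    Convexity ([cross]) makes these bounds compatible, and the Slater point [y0] makes the largest
    lower bound finite. *)
Lemma lagrange_multiplier n (K : set 'rV[R]_n) (I D : 'rV[R]_n -> R) (c d : R) y0 :
  (forall x y s, K x -> K y -> 0 <= s <= 1 ->
    [/\ K (s *: x + (1 - s) *: y),
        I (s *: x + (1 - s) *: y) <= s * I x + (1 - s) * I y &
        D (s *: x + (1 - s) *: y) <= s * D x + (1 - s) * D y]) ->
  (forall y, K y -> I y < c -> d < D y) ->
  K y0 -> D y0 < d ->
  exists2 lam, 0 <= lam & forall y, K y -> c + lam * d <= I y + lam * D y.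
Proof.
move=> cvx hID Ky0 Dy0.
have cross y1 y2 : K y1 -> I y1 < c -> K y2 -> D y2 < d ->
    (c - I y1) / (D y1 - d) <= (I y2 - c) / (d - D y2).
  move=> K1 I1 K2 D2; have D1 := hID _ K1 I1.
  (* The weight at which the interpolated values of [D] equal [d]; the point [z] there has
     [D z <= d], hence [c <= I z]. *)
  pose s := (d - D y2) / (D y1 - D y2).
  have D12 : 0 < D y1 - D y2 by lra.
  have s01 : 0 <= s <= 1.
    by rewrite divr_ge0 ?(ltW D12)//= ?ler_pdivrMr ?mul1r//; lra.
  have [Kz Iz Dz] := cvx y1 y2 s K1 K2 s01.
  have dE : s * D y1 + (1 - s) * D y2 = d by rewrite /s; field; lra.
  rewrite dE in Dz.
  have cz : c <= s * I y1 + (1 - s) * I y2.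
    apply: le_trans Iz; rewrite leNgt; apply/negP => /(hID _ Kz).
    by rewrite ltNge Dz.
  rewrite ler_pdivrMr ?subr_gt0// mulrAC ler_pdivlMr ?subr_gt0//.
  have := ler_wpM2r (ltW D12) cz.
  have -> : (s * I y1 + (1 - s) * I y2) * (D y1 - D y2) =
    (d - D y2) * I y1 + (D y1 - d) * I y2 by rewrite /s; field; lra.
  by move=> ?; nra.
pose S := [set (c - I y) / (D y - d) | y in [set y | K y /\ I y < c]].
have ubS : has_ubound S.
  by exists ((I y0 - c) / (d - D y0)) => _ [y [Ky Iy] <-]; exact: cross.
have lam0 : 0 <= sup S.
  (* If no point has [I y < c], then [sup S] is 0, a valid multiplier. *)
  have [->|/set0P[u Su]] := eqVneq S set0; first by rewrite sup0.
  apply: le_trans (ub_le_sup ubS Su); case: Su => y [Ky Iy] <-.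
  by rewrite divr_ge0// subr_ge0 ltW// hID.
exists (sup S) => // y Ky.
have [Iy|Iy] := ltP (I y) c.
  have Dy := hID _ Ky Iy.
  have : (c - I y) / (D y - d) <= sup S by apply: ub_le_sup => //; exists y.
  by rewrite ler_pdivrMr ?subr_gt0// mulrBr; lra.
have [Dy|Dy] := leP d (D y).
  by rewrite lerD// ler_wpM2l.
suff : sup S <= (I y - c) / (d - D y) by rewrite ler_pdivlMr ?subr_gt0// mulrBr; lra.
have [->|S0] := eqVneq S set0; first by rewrite sup0 divr_ge0//; lra.
by apply: ge_sup => [|_ [z [Kz Iz] <-]]; [exact/set0P|exact: cross].
Qed.

End Lagrange.

(** * Cauchy-Schwarz and support functions of bounded sets *)

Section Support.
Variable R : realType.

Lemma dotvC n (u v : 'rV[R]_n) : dotv u v = dotv v u.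
Proof. by apply: eq_bigr => i _; rewrite mulrC. Qed.

Lemma dotvDr n (u v w : 'rV[R]_n) : dotv u (v + w) = dotv u v + dotv u w.
Proof. by rewrite -big_split; apply: eq_bigr => i _; rewrite mxE mulrDr. Qed.

Lemma dotvZr n a (u v : 'rV[R]_n) : dotv u (a *: v) = a * dotv u v.
Proof. by rewrite mulr_sumr; apply: eq_bigr => i _; rewrite mxE mulrCA. Qed.

Lemma dotv_ge0 n (u : 'rV[R]_n) : 0 <= dotv u u.
Proof. by apply: sumr_ge0 => i _; rewrite -expr2 sqr_ge0. Qed.

Lemma dotv_eq0 n (u v : 'rV[R]_n) : dotv u u <= 0 -> dotv u v = 0.
Proof.
move=> u0; have /psumr_eq0P uu : dotv u u = 0 by apply/le_anti; rewrite u0 dotv_ge0.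
apply: big1 => i _; have /eqP := uu (fun j _ => sqr_ge0 (u ord0 j)) i isT.
by rewrite mulf_eq0 orbb => /eqP ->; rewrite mul0r.
Qed.

(** Cauchy-Schwarz, from [2xy <= (b/a) x^2 + (a/b) y^2] summed over the coordinates; zero radii are
    treated apart because of the divisions. *)
Lemma dotv_le n (u v : 'rV[R]_n) a b : 0 <= a -> 0 <= b ->
  dotv u u <= a ^+ 2 -> dotv v v <= b ^+ 2 -> dotv u v <= a * b.
Proof.
move=> a0 b0 ua vb.
have [a00|an0] := eqVneq a 0.
  by rewrite dotv_eq0 ?mulr_ge0//; rewrite a00 expr0n in ua.
have [b00|bn0] := eqVneq b 0.
  by rewrite dotvC dotv_eq0 ?mulr_ge0//; rewrite b00 expr0n in vb.
have {an0}a0 : 0 < a by rewrite lt_def an0.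
have {bn0}b0 : 0 < b by rewrite lt_def bn0.
have h : 2 * dotv u v <= b / a * dotv u u + a / b * dotv v v.
  rewrite !mulr_sumr -big_split ler_sum// => i _ /=.
  move: (u ord0 i) (v ord0 i) => x y; rewrite -subr_ge0.
  have -> : b / a * (x * x) + a / b * (y * y) - 2 * (x * y) =
      a * b * (x / a - y / b) ^+ 2 by field; rewrite !gt_eqF.
  by rewrite mulr_ge0 ?sqr_ge0// ltW// mulr_gt0.
have := ler_wpM2l (ltW (divr_gt0 b0 a0)) ua.
have := ler_wpM2l (ltW (divr_gt0 a0 b0)) vb.
have -> : a / b * b ^+ 2 = a * b by field; rewrite gt_eqF.
have -> : b / a * a ^+ 2 = a * b by field; rewrite gt_eqF.
by lra.
Qed.

(** The support function [D] of the overview. [sup] is 0 on empty or unbounded sets, so the lemmas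
    carry a member of [V] or a radius [L]. *)
Definition supp n (V : set 'rV[R]_n) (v : 'rV[R]_n) : R :=
  sup [set dotv xi v | xi in V].

Lemma dotv_le_supp n (V : set 'rV[R]_n) L xi v :
  (forall xi, V xi -> dotv xi xi <= L ^+ 2) -> V xi -> dotv xi v <= supp n V v.
Proof.
move=> VL Vxi; apply: ub_le_sup; last by exists xi.
exists (`|L| * l2norm v) => _ [u Vu <-]; apply: dotv_le => //.
- exact: sqrtr_ge0.
- by rewrite real_normK ?num_real ?VL.
- by rewrite sqr_sqrtr ?dotv_ge0.
Qed.

Lemma supp_le n (V : set 'rV[R]_n) v M : V !=set0 ->
  (forall xi, V xi -> dotv xi v <= M) -> supp n V v <= M.
Proof.
move=> [x Vx] VM; apply: ge_sup => [|_ [xi Vxi <-]]; last exact: VM.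
by exists (dotv x v); exists x.
Qed.

Lemma convex_supp n (V : set 'rV[R]_n) L : V !=set0 ->
  (forall xi, V xi -> dotv xi xi <= L ^+ 2) -> convex_rV R n (supp n V).
Proof.
move=> V0 VL x y s /andP[s0 s1]; apply: supp_le => // xi Vxi.
rewrite dotvDr !dotvZr lerD// ler_wpM2l ?subr_ge0//; exact: (dotv_le_supp _ _ L).
Qed.

Lemma suppZ_le n (V : set 'rV[R]_n) L a v : V !=set0 -> 0 <= a ->
  (forall xi, V xi -> dotv xi xi <= L ^+ 2) -> supp n V (a *: v) <= a * supp n V v.
Proof.
move=> V0 a0 VL; apply: supp_le => // xi Vxi.
by rewrite dotvZr ler_wpM2l//; exact: (dotv_le_supp _ _ L).
Qed.

Lemma supp_le_mul n (V : set 'rV[R]_n) L b v : V !=set0 -> 0 <= L -> 0 <= b ->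
  (forall xi, V xi -> dotv xi xi <= L ^+ 2) -> dotv v v <= b ^+ 2 ->
  - (L * b) <= supp n V v <= L * b.
Proof.
move=> V0 L0 b0 VL vb; apply/andP; split; last first.
  by apply: supp_le => // xi Vxi; apply: dotv_le => //; apply: VL.
have [xi Vxi] := V0; apply: le_trans (dotv_le_supp _ _ L xi v VL Vxi).
rewrite lerNl -mulN1r -dotvZr; apply: dotv_le => //; first exact: VL.
by rewrite dotvZr dotvC dotvZr !mulN1r opprK.
Qed.

End Support.

(** * Gradients on the cube and the mean value theorem *)

Section Gradient.
Variable R : realType.

Lemma derive_dotv_grad n (f : 'rV[R]_n -> R) z v :
  differentiable f z -> 'D_v f z = dotv (grad f z) v.
Proof.
move=> dfz; rewrite deriveE// [in LHS](row_sum_delta v) linear_sum.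
apply: eq_bigr => i _.
by rewrite linearZ mxE /partial deriveE// mulrC.
Qed.

Lemma is_derive_line n (f : 'rV[R]_n -> R) y v (s : R) :
  differentiable f (s *: v + y) ->
  is_derive s 1 (fun s => f (s *: v + y)) (dotv (grad f (s *: v + y)) v).
Proof.
move=> dfz; rewrite -derive_dotv_grad//.
set z := s *: v + y in dfz *.
have E : (fun h : R => h^-1 *: (((fun s => f (s *: v + y)) \o shift s) (h *: 1) - f z))
       = (fun h : R => h^-1 *: ((f \o shift z) (h *: v) - f z)).
  by apply/funext => h /=; rewrite [h *: 1]mulr1 scalerDl addrA.
apply: DeriveDef; rewrite /derivable /derive ?E//.
exact: diff_derivable.
Qed.

Lemma cube_comb n (x y : 'rV[R]_n) s : cube n x -> cube n y -> 0 <= s <= 1 ->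
  cube n (s *: x + (1 - s) *: y).
Proof.
move=> cx cy s01 i; have := cx i; have := cy i; rewrite !mxE.
by move: (x ord0 i) (y ord0 i) => a b ? ?; nra.
Qed.

(** The one-variable theorem on the segment from [y] to [x]; convexity keeps [z] in the cube, so its
    gradient belongs to [V]. *)
Lemma mean_value_cube n (f : 'rV[R]_n -> R) x y : C1_near_cube f ->
  cube n x -> cube n y ->
  exists2 z, cube n z & f x - f y = dotv (grad f z) (x - y).
Proof.
move=> [U [_ [cU [dU _]]]] cx cy.
have cz (s : R) : 0 <= s <= 1 -> cube n (s *: (x - y) + y).
  move=> s01; have := cube_comb n x y s cx cy s01.
  by congr (cube n _); rewrite scalerBr scalerBl scale1r addrA addrAC.
have df (s : R) : 0 <= s <= 1 -> is_derive s 1 (fun s => f (s *: (x - y) + y))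
    (dotv (grad f (s *: (x - y) + y)) (x - y)).
  by move=> s01; apply: is_derive_line; apply/dU/cU/cz.
have [s sI||s sI] := @MVT R (fun s => f (s *: (x - y) + y))
    (fun s => dotv (grad f (s *: (x - y) + y)) (x - y)) 0 1 (@ltr01 R).
- by apply: df; move: sI; rewrite in_itv/= => /andP[/ltW -> /ltW ->].
- apply: continuous_in_subspaceT => s; rewrite inE /= in_itv/= => s01.
  apply/differentiable_continuous/derivable1_diffP.
  by have [] := df s s01.
rewrite scale1r subrK scale0r add0r subr0 mulr1 => E.
exists (s *: (x - y) + y) => //; apply: cz.
by move: sI; rewrite in_itv/= => /andP[/ltW -> /ltW ->].
Qed.

Lemma compact_cube n : compact (@cube R n).
Proof.
have /rV_compact : forall i : 'I_n, compact `[-1 : R, 1]%classic.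
  by move=> _; exact: segment_compact.
congr compact; apply/seteqP; split => v cv i; have := cv i => /=; by rewrite in_itv.
Qed.

Lemma coord_le_norm n (v : 'rV[R]_n) i : `|v ord0 i| <= `|v|.
Proof.
rewrite [leRHS]/Num.norm /= mx_normrE; apply/bigmax_geP; right => /=.
by exists (ord0, i).
Qed.

(** [sup] bounds its set only if that set is bounded; here this follows from continuity of the
    gradient on the compact cube. *)
Lemma grad_le_Lgrad n (f : 'rV[R]_n -> R) x : C1_near_cube f -> cube n x ->
  l2norm (grad f x) <= Lgrad f.
Proof.
move=> [U [_ [cU [_ gU]]]] cx; apply: ub_le_sup; last by exists x.
have : compact (grad f @` cube n).
  apply: continuous_compact (compact_cube n).
  by apply: continuous_in_subspaceT => z /set_mem/cU/gU.
move=> /compact_bounded[M [_ hM]].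
exists (Num.sqrt (\sum_(i < n) (M + 1) ^+ 2)) => _ [z cz <-].
apply: ler_wsqrtr; apply: ler_sum => i _.
(* [compact_bounded] provides a bound by every real strictly above [M], hence [M + 1]. *)
have gM : `|grad f z| <= M + 1 by apply: hM; rewrite ?ltrDl//; exists z.
have := le_trans (coord_le_norm n (grad f z) i) gM.
rewrite -expr2 -real_normK ?num_real// => h.
by rewrite ler_pXn2r ?nnegrE// (le_trans _ h).
Qed.

End Gradient.

(** * A numerical lower bound for the logarithmic factor *)

Section Numeric.
Variable R : realType.

Lemma expR4_3_le : expR (4 / 3 : R) <= 13 / 3.
Proof.
have e6 : 5 / 6 <= expR (- (1 / 6) : R).
  by apply: le_trans (expR_ge1Dx _); lra.
have e1 : expR (1 / 6 : R) <= 6 / 5.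
  have := expRxMexpNx_1 (1 / 6 : R); have := expR_gt0 (1 / 6 : R).
  by move: (expR (1 / 6)) (expR (- _)) e6 => a b; nra.
have -> : 4 / 3 = 8%:R * (1 / 6) :> R by field.
rewrite expRM_natl; apply: (@le_trans _ _ ((6 / 5) ^+ 8)); last by lra.
by rewrite lerXn2r ?nnegrE ?expR_ge0//; lra.
Qed.

(* Tangent lines of [-ln q] and [-ln (1 - q)] at [q = 10/13] and [1 - q = 3/10]. *)
Lemma ln_inv_ge (q : R) : 0 < q < 1 -> 61 / 30 * q <= ln (1 / (q * (1 - q))).
Proof.
move=> /andP[q0 q1]; have q1' : 0 < 1 - q by lra.
rewrite div1r lnV ?lnM ?posrE ?mulr_gt0//.
have a0 : 0 < 13 / 10 :> R by lra.
have b0 : 0 < 10 / 3 :> R by lra.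
have := ln_le_subr1 R (13 / 10 * q) (mulr_gt0 a0 q0).
have := ln_le_subr1 R (10 / 3 * (1 - q)) (mulr_gt0 b0 q1').
rewrite (lnM a0 q0) (lnM b0 q1').
(* The tangent lines have total slope [10/3 - 13/10 = 61/30] and total constant [ln (13/3) - 4/3],
   which is nonnegative. *)
have : 4 / 3 <= ln (13 / 10 * (10 / 3) : R).
  rewrite -[leLHS]expRK ler_ln ?posrE ?expR_gt0 ?mulr_gt0//.
  by apply: le_trans expR4_3_le _; lra.
by rewrite (lnM a0 b0); lra.
Qed.

End Numeric.

(** * Real-valued rate and the bound for one multiplier *)

Section UpperTail.
Variable R : realType.

Definition ratev n (p : R) (y : 'rV[R]_n) : R := \sum_(i < n) rate R p (y ord0 i).

Lemma ratev_ge0 n p y : 0 < p < 1 -> cube n y -> 0 <= ratev n p y.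
Proof. by move=> p01 cy; apply: sumr_ge0 => i _; apply: rate_ge0 p01 (cy i). Qed.

Lemma Ip_cube n p (y : 'rV[R]_n) : cube n y -> Ip p y = (ratev n p y)%:E.
Proof.
move=> cy; rewrite /ratev -sumEFin; apply: eq_bigr => i _.
by rewrite /Ip1 cy.
Qed.

Lemma phi_le n p (f : 'rV[R]_n -> R) s y : cube n y -> s <= f y ->
  (phi p f s <= (ratev n p y)%:E)%E.
Proof. by move=> cy sy; rewrite -Ip_cube//; apply: ereal_inf_lbound; exists y. Qed.

Lemma phi_ge0 n p (f : 'rV[R]_n -> R) s : 0 < p < 1 -> (0 <= phi p f s)%E.
Proof.
move=> p01; apply: le_ereal_inf_tmp => _ [y [cy _] <-].
by rewrite Ip_cube// lee_fin ratev_ge0.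
Qed.

Lemma cube_sgnv n (w : {ffun 'I_n -> bool}) : cube n (sgnv R w).
Proof. by move=> i; rewrite mxE; case: ifP => _; lra. Qed.

Lemma dotv_le_coord n (v : 'rV[R]_n) r : 0 <= r ->
  (forall i, - r <= v ord0 i <= r) -> dotv v v <= (r * Num.sqrt n%:R) ^+ 2.
Proof.
move=> r0 vr; rewrite exprMn sqr_sqrtr ?ler0n//.
rewrite -[X in _ * X%:R]card_ord mulr_natr -sumr_const.
apply: ler_sum => i _; rewrite -expr2 -real_normK ?num_real//.
by rewrite lerXn2r ?nnegrE// ler_norml.
Qed.

Lemma dotv_sgnv_sub n (w : {ffun 'I_n -> bool}) y : cube n y ->
  dotv (sgnv R w - y) (sgnv R w - y) <= (2 * Num.sqrt n%:R) ^+ 2.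
Proof.
move=> cy; apply: dotv_le_coord => // i; rewrite !mxE.
by have /andP[] := cy i; case: ifP => _; lra.
Qed.

Lemma slice_prob_le n (p : R) (V : set 'rV[R]_n) (L lam g0 : R)
    (P : pred {ffun 'I_n -> bool}) :
  0 < p < 1 -> V !=set0 -> 0 <= L -> (forall xi, V xi -> dotv xi xi <= L ^+ 2) ->
  0 <= lam ->
  (forall w y, P w -> cube n y ->
     g0 <= ratev n p y + lam * supp R n V (sgnv R w - y)) ->
  \sum_(w | P w) mupn_weight p w <= expR (2 * lam * bV V - g0).
Proof.
move=> p01 V0 L0 VL lam0 hP.
(* Outside [P] the value is low enough for the transport hypothesis to hold automatically; those
   positive terms are then dropped. *)
pose g w := if P w then g0 else - (lam * (L * (2 * Num.sqrt n%:R))).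
have cvx : convex_rV R n (fun v => lam * supp R n V v).
  move=> x y s s01; rewrite !(mulrCA _ lam) -mulrDr ler_wpM2l//.
  exact: convex_supp VL _ _ _ s01.
have hg w y : cube n y -> g w <= ratev n p y + lam * supp R n V (sgnv R w - y).
  move=> cy; rewrite /g; case: ifPn => Pw; first exact: hP.
  have /andP[h _] := supp_le_mul R n V L (2 * Num.sqrt n%:R) (sgnv R w - y) V0 L0
    (mulr_ge0 (ler0n R 2) (sqrtr_ge0 _)) VL (dotv_sgnv_sub n w y cy).
  have := ler_wpM2l lam0 h; rewrite mulrN => {}h.
  by apply: le_trans h _; rewrite lerDr ratev_ge0.
have H := cube_transport R n p _ g p01 cvx hg.
have {}H : \sum_(w | P w) mupn_weight p w * expR g0 <= expR (2 * lam * bV V).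
  apply: le_trans (le_trans H _).
    rewrite [leLHS]big_mkcond ler_sum// => w _; rewrite /g.
    by case: ifP => _//; rewrite mulr_ge0 ?expR_ge0 ?ltW ?mupn_weight_gt0.
  rewrite ler_expR /bV mulrCA ler_wpM2l// mulr_sumr ler_sum// => w _.
  by rewrite (mulrC 2) -mulrA ler_wpM2l//; exact: suppZ_le VL.
by rewrite expRB ler_pdivlMr ?expR_gt0// mulr_suml.
Qed.

End UpperTail.

(** * Size of the final logarithm and existence of multipliers *)

Section Main.
Variable R : realType.

Section Fixed.
Variables (n : nat) (p : R) (f : 'rV[R]_n -> R) (t delta : R).
Hypotheses (p01 : 0 < p < 1) (fC1 : C1_near_cube f) (delta0 : 0 < delta).

Let V := grad f @` cube n.
Let D := supp R n V.
Let L := Lgrad f.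
Let lg := ln (1 / (p * (1 - p))).
Let sn := Num.sqrt n%:R : R.

Lemma cube0 : cube n (0 : 'rV[R]_n).
Proof. by move=> i; rewrite mxE; lra. Qed.

Lemma image_grad_neq0 : V !=set0.
Proof. by exists (grad f 0); exists 0 => //; exact: cube0. Qed.

Lemma Lgrad_ge0 : 0 <= L.
Proof. by apply: le_trans (grad_le_Lgrad _ _ _ _ fC1 cube0); exact: sqrtr_ge0. Qed.

Lemma dotv_grad_le xi : V xi -> dotv xi xi <= L ^+ 2.
Proof.
move=> [x cx <-]; rewrite -[leLHS]sqr_sqrtr ?dotv_ge0//.
by rewrite lerXn2r ?nnegrE ?sqrtr_ge0 ?Lgrad_ge0//; exact: grad_le_Lgrad.
Qed.

Lemma sub_le_supp x y : cube n x -> cube n y -> f x - f y <= D (x - y).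
Proof.
move=> cx cy; have [z cz ->] := mean_value_cube R n f x y fC1 cx cy.
by apply: dotv_le_supp dotv_grad_le _; exists z.
Qed.

(* The mean [2p - 1] of [mu_p^n] has [I_p = 0], so it cannot lie in [f > t - delta]. *)
Lemma delta_le_mean w :
  (forall s : R, t - delta < s -> (phi p f (t - delta) < phi p f s)%E) ->
  t <= f (sgnv R w) -> delta <= L * (2 * Num.max p (1 - p) * sn).
Proof.
move=> hphi tw; have /andP[p0 p1] := p01.
pose m : 'rV[R]_n := \row_i (2 * p - 1).
have cm : cube n m by move=> i; rewrite mxE; lra.
have fm : f m <= t - delta.
  rewrite leNgt; apply/negP => /hphi; apply/negP; rewrite -leNgt.
  apply: le_trans (phi_ge0 _ _ _ _ _ p01).
  apply: le_trans (phi_le R n p f _ m cm (lexx _)) _.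
  by rewrite lee_fin /ratev big1// => i _; rewrite mxE rate_mean.
have : f (sgnv R w) - f m <= D (sgnv R w - m) by apply: sub_le_supp => //; exact: cube_sgnv.
suff : D (sgnv R w - m) <= L * (2 * Num.max p (1 - p) * sn) by lra.
have mx0 : 0 <= 2 * Num.max p (1 - p) by rewrite mulr_ge0// le_max (ltW p0).
have b0 : 0 <= 2 * Num.max p (1 - p) * sn by rewrite mulr_ge0 ?sqrtr_ge0.
have hv : dotv (sgnv R w - m) (sgnv R w - m) <= (2 * Num.max p (1 - p) * sn) ^+ 2.
  apply: dotv_le_coord => // i; rewrite !mxE.
  have hp : p <= Num.max p (1 - p) by rewrite le_max lexx.
  have hq : 1 - p <= Num.max p (1 - p) by rewrite le_max lexx orbT.
  by case: ifP => _; lra.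
by have /andP[] := supp_le_mul R n V L _ _ image_grad_neq0 Lgrad_ge0 b0 dotv_grad_le hv.
Qed.

(** The bounds on [delta] and [lg] are both proportional to [max p (1 - p)], which cancels;
    [n / sqrt n] leaves the factor [sn]. *)
Lemma log_arg_ge w :
  (forall s : R, t - delta < s -> (phi p f (t - delta) < phi p f s)%E) ->
  t <= f (sgnv R w) -> 61 / 60 * sn <= n%:R * L * lg / delta.
Proof.
move=> hphi tw; have h := delta_le_mean w hphi tw.
have lgE : 61 / 30 * Num.max p (1 - p) <= lg.
  rewrite /lg; case: (leP p (1 - p)) => _; last exact: ln_inv_ge.
  have := ln_inv_ge R (1 - p); rewrite subKr (mulrC (1 - p)); apply.
  by have /andP[] := p01; lra.
have s0 : 0 <= sn by exact: sqrtr_ge0.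
have snn : n%:R = sn ^+ 2 by rewrite sqr_sqrtr ?ler0n.
rewrite ler_pdivlMr//.
apply: le_trans (ler_wpM2l _ h) _; first by rewrite mulr_ge0.
rewrite [leLHS](_ : _ = n%:R * L * (61 / 30 * Num.max p (1 - p))).
  by rewrite ler_wpM2l// mulr_ge0 ?ler0n ?Lgrad_ge0.
by rewrite snn; field.
Qed.

(** The Slater point is [x] itself, as [D 0 <= 0 < delta]. Evaluating at [y = x], where the rate is
    at most [n * lg], bounds [lam]. *)
Lemma multiplier_exists c w : 0 <= c -> phi p f (t - delta) = c%:E ->
  t <= f (sgnv R w) ->
  exists lam, 0 <= lam <= n%:R * lg / delta /\
    forall y, cube n y -> c + lam * delta <= ratev R n p y + lam * D (sgnv R w - y).
Proof.
move=> c0 phic tw; set x := sgnv R w.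
have cx : cube n x := cube_sgnv R n w.
have D0 : D (x - x) <= 0.
  apply: supp_le image_grad_neq0 _ => xi _.
  by rewrite subrr /dotv big1// => i _; rewrite mxE mulr0.
have [|y cy Iy| |//|lam lam0 hlam] :=
    lagrange_multiplier R n (cube n) (ratev R n p) (fun y => D (x - y)) c delta x.
- move=> y z s cy cz s01; split; first exact: cube_comb.
    rewrite /ratev !mulr_sumr -big_split ler_sum// => i _; rewrite !mxE.
    exact: rate_convex (cy i) (cz i) s01.
  have := convex_supp R n V L image_grad_neq0 dotv_grad_le (x - y) (x - z) s s01.
  congr (D _ <= _); rewrite !scalerBr addrACA -scalerDl subrKC scale1r.
  by rewrite opprD.
(* A point of rate below [c] cannot have [t - delta <= f y], so [f] drops by more than [delta] from
   [x] to [y]. *)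
- apply: lt_le_trans (sub_le_supp _ _ cx cy).
  suff : f y < t - delta by lra.
  rewrite ltNge; apply/negP => /(phi_le R n p f _ y cy).
  by rewrite phic lee_fin leNgt Iy.
- exact: cx.
- by apply: le_lt_trans D0 delta0.
exists lam; split=> //; rewrite lam0 /= ler_pdivlMr//.
have := hlam x cx; have := ler_wpM2l lam0 D0; rewrite mulr0.
suff : ratev R n p x <= n%:R * lg by lra.
rewrite -[n in n%:R]card_ord mulr_natl -sumr_const ler_sum// => i _.
by rewrite mxE; exact: rate_sign.
Qed.

End Fixed.
End Main.

(** * Union bound over a mesh of multipliers *)

Section Cover.
Variable R : realType.

Lemma sum_le_cover (I : finType) (J : nat) (F : I -> R) (A : pred I)
    (P : 'I_J -> pred I) M :
  (forall i, 0 <= F i) -> (forall i, A i -> exists j, P j i) ->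
  (forall j, \sum_(i | P j i) F i <= M) ->
  \sum_(i | A i) F i <= J%:R * M.
Proof.
move=> F0 AP PM; apply: (@le_trans _ _ (\sum_(j < J) \sum_(i | P j i) F i)).
  under [leRHS]eq_bigr do rewrite big_mkcond.
  rewrite exchange_big [leLHS]big_mkcond ler_sum// => i _ /=.
  have [Ai|_] := ifPn; last by apply: sumr_ge0 => j _; case: ifP.
  have [j Pj] := AP i Ai; rewrite (bigD1 j)//= Pj lerDl sumr_ge0// => k _.
  by case: ifP.
rewrite mulr_natl -[X in _ *+ X]card_ord -sumr_const.
by apply: ler_sum => j _; exact: PM.
Qed.

(* The multipliers lie between 0 and [B]; rounding one down to a multiple of the mesh
   [h = 1 / (L * (2 * sqrt n))] costs at most 1 in the exponent. *)
Lemma prob_ge_le n (p : R) (f : 'rV[R]_n -> R) (t delta c B : R) :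
  0 < p < 1 -> C1_near_cube f -> 0 < delta ->
  bV (grad f @` cube n) <= delta / 2 ->
  0 < Lgrad f * (2 * Num.sqrt n%:R) -> 0 <= B ->
  (forall w, t <= f (sgnv R w) -> exists lam, 0 <= lam <= B /\
     forall y, cube n y -> c + lam * delta <=
       ratev R n p y + lam * supp R n (grad f @` cube n) (sgnv R w - y)) ->
  prob_ge p f t <= (B * (Lgrad f * (2 * Num.sqrt n%:R)) + 1) * expR (1 - c).
Proof.
move=> p01 fC1 delta0 bVd; set V := grad f @` cube n; set k := Lgrad f * _ => k0 B0 hlam.
have L0 := Lgrad_ge0 R n f fC1.
have V0 : V !=set0 := image_grad_neq0 R n f.
have VL := dotv_grad_le R n f fC1.
pose J := (Num.truncn (B * k)).+1.
(* The slack [- 1] in the inequality absorbs the rounding of [lam] down to [j / k]. *)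
pose P (j : 'I_J) (w : {ffun 'I_n -> bool}) := `[< forall y, cube n y ->
  c + j%:R / k * delta - 1 <= ratev R n p y + j%:R / k * supp R n V (sgnv R w - y) >].
apply: (@le_trans _ _ (J%:R * expR (1 - c))); last first.
  by rewrite ler_wpM2r ?expR_ge0// /J -natr1 lerD2r truncn_le mulr_ge0// ltW.
apply: (@sum_le_cover _ J _ _ P) => [w|w tw|j].
- by rewrite ltW ?mupn_weight_gt0.
- have [lam [/andP[lam0 lamB] hw]] := hlam w tw.
  have lk0 : 0 <= lam * k by rewrite mulr_ge0// ltW.
  have jJ : (Num.truncn (lam * k) < J)%N by rewrite ltnS le_truncn// ler_pM2r.
  exists (Ordinal jJ); apply/asboolP => y cy /=.
  have /andP[] := truncn_itv lk0; set j := Num.truncn _ => j1 j2.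
  have := hw y cy.
  have /andP[_ hs] := supp_le_mul R n V (Lgrad f) (2 * Num.sqrt n%:R) (sgnv R w - y) V0 L0
    (mulr_ge0 (ler0n R 2) (sqrtr_ge0 _)) VL (dotv_sgnv_sub R n w y cy).
  rewrite -/k in hs; move: hs; set s := supp _ _ _ _ => hs.
  have r0 : 0 <= lam - j%:R / k by rewrite subr_ge0 ler_pdivrMr.
  have r1 : lam - j%:R / k <= 1 / k.
    by rewrite lerBlDl -mulrDl ler_pdivlMr// natr1 ltW.
  have rs : (lam - j%:R / k) * s <= 1.
    apply: le_trans (ler_wpM2l r0 hs) _.
    by apply: le_trans (ler_wpM2r (ltW k0) r1) _; rewrite divfK ?gt_eqF.
  have rd : 0 <= (lam - j%:R / k) * delta by rewrite mulr_ge0// ltW.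
  by move: rs rd; rewrite !mulrBl; lra.
- have jk0 : 0 <= j%:R / k by rewrite divr_ge0// ltW.
  have := slice_prob_le R n p V (Lgrad f) (j%:R / k) (c + j%:R / k * delta - 1) (P j)
    p01 V0 L0 VL jk0.
  move=> H; apply: le_trans (H _) _ => [w y /asboolP|]; first exact.
  (* Here [kappa = 2] matters: [2 * bV V <= delta] cancels the multiplier in the exponent. *)
  rewrite ler_expR; have := ler_wpM2l jk0 bVd.
  by rewrite -/V; lra.
Qed.

End Cover.

(** Positivity of the probability separates off the trivial case of logarithm -oo, since [ln 0] is
    0. *)
Theorem theorem2p12 (R : realType) :
  exists C kappa : R, 0 < C /\ 0 < kappa /\
  forall (n : nat) (p : R) (f : 'rV[R]_n -> R) (t delta : R),
    0 < p < 1 ->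
    C1_near_cube f ->
    0 < delta ->
    (forall s : R, t - delta < s -> (phi p f (t - delta) < phi p f s)%E) ->
    bV (grad f @` cube n) <= delta / kappa ->
    0 < prob_ge p f t ->
    ((ln (prob_ge p f t))%:E <=
       - phi p f (t - delta)
       + (C * ln (n%:R * Lgrad f * ln (1 / (p * (1 - p))) / delta))%:E)%E.
Proof.
have ln0 : 0 < ln (61 / 60 : R) by apply: ln_gt0; lra.
have ln3 : 0 < ln (3 : R) by apply: ln_gt0; lra.
(* The 2 comes from [N ^+ 2]; the quotient turns the additive constant [1 + ln 3] into a multiple of
   [ln N]. *)
exists (2 + (1 + ln 3) / ln (61 / 60)), 2; split; [|split] => //.
  by rewrite addr_gt0// divr_gt0// addr_gt0.
move=> n p f t delta p01 fC1 delta0 hphi bVd P0.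
have [w0 tw0] : exists w, t <= f (sgnv R w).
  apply: contrapT => /forallNP nw; move: P0; rewrite /prob_ge big_pred0 ?ltxx// => w.
  by apply/negP/nw.
have hmean := delta_le_mean R n p f t delta p01 fC1 w0 hphi tw0.
have hN := log_arg_ge R n p f t delta p01 fC1 delta0 w0 hphi tw0.
set N := _ / delta in hN *; set sn := Num.sqrt n%:R in hmean hN.
have L0 := Lgrad_ge0 R n f fC1; have s0 : 0 <= sn := sqrtr_ge0 _.
have lg0 : 0 <= ln (1 / (p * (1 - p))).
  have := ln_inv_ge R p p01; have /andP[p0 _] := p01; lra.
have [mx0 mx1] : 0 < Num.max p (1 - p) /\ Num.max p (1 - p) <= 1.
  have /andP[p0 p1] := p01; split; first by rewrite lt_max p0.
  by rewrite ge_max; lra.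
have k0 : 0 < Lgrad f * (2 * sn).
  have : 0 < Lgrad f * (2 * Num.max p (1 - p) * sn) by apply: lt_le_trans hmean.
  rewrite [X in 0 < X](_ : _ = Num.max p (1 - p) * (Lgrad f * (2 * sn))); last by ring.
  by rewrite pmulr_rgt0.
have n1 : 1 <= sn.
  have n0 : (0 < n)%N.
    rewrite lt0n; apply/eqP => n0; have sn0 : sn = 0 by rewrite /sn n0 sqrtr0.
    by move: k0; rewrite sn0 !mulr0 ltxx.
  by rewrite -[leLHS]sqrtr1 ler_wsqrtr// ler1n.
case phic : (phi p f (t - delta)) => [c| |].
- have c0 : 0 <= c by have := phi_ge0 R n p f (t - delta) p01; rewrite phic lee_fin.
  set B := n%:R * ln (1 / (p * (1 - p))) / delta.
  have B0 : 0 <= B by rewrite divr_ge0 ?mulr_ge0 ?ler0n// ltW.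
  have := prob_ge_le R n p f t delta c B p01 fC1 delta0 bVd k0 B0
    (fun w => multiplier_exists R n p f t delta p01 fC1 delta0 c w c0 phic).
  have N1 : 61 / 60 <= N by nra.
  have -> : B * (Lgrad f * (2 * Num.sqrt n%:R)) = 2 * sn * N.
    by rewrite /B /N /sn; field; rewrite gt_eqF.
  move=> hP; rewrite -EFinN -EFinD lee_fin.
  (* [sn <= N] and [1 <= N] give [2 * sn * N + 1 <= 3 * N ^+ 2]. *)
  have Pe : prob_ge p f t <= 3 * N ^+ 2 * expR (1 - c).
    by apply: le_trans hP _; rewrite ler_wpM2r ?expR_ge0//; nra.
  have N0 : 0 < N by lra.
  have N3 : 0 < 3 * N ^+ 2 by rewrite mulr_gt0 ?exprn_gt0.
  have : ln (prob_ge p f t) <= ln (3 * N ^+ 2 * expR (1 - c)).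
    by rewrite ler_ln ?posrE// mulr_gt0 ?expR_gt0.
  rewrite (lnM N3) ?posrE ?expR_gt0// expRK (@lnM _ 3) ?posrE ?exprn_gt0// lnXn//.
  have lnN : ln (61 / 60) <= ln N by rewrite ler_ln ?posrE//; lra.
  have : 1 + ln 3 <= (1 + ln 3) / ln (61 / 60) * ln N.
    by rewrite mulrAC ler_pdivlMr// ler_wpM2l//; lra.
  by rewrite mulrDl; lra.
(* The value [+oo] contradicts the strict inequality of [hphi] at [s = t]. *)
- have := hphi t; rewrite phic ltrBlDr ltrDl => /(_ delta0).
  by rewrite ltNge leey.
- by have := phi_ge0 R n p f (t - delta) p01; rewrite phic.
Qed.
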